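(* Let $n$ and $k$ be integers with $3\leq k\leq n-1$. A graph $G$ on $n$ vertices is the $(1,2)$-step competition graph $C_{1,2}(T)$ of some $k$-hypertournament $T$ on $n$ vertices if and only if $G$ is $K_{n}$, $K_{n}-E(P_{2})$, $K_{n}-E(P_{3})$, or $K_{n-1}\cup K_{1}$.
   Context: Given integers $n\geq k>1$, a $k$-hypertournament on $n$ vertices is a pair $T=(V,A)$ where $|V|=n$ and $A$ is a set of $k$-tuples of distinct vertices (arcs) such that for every $k$-subset $S$ of $V$, $A$ contains exactly one of the $k!$ $k$-tuples whose entries are the elements of $S$. If $v_i,v_j$ both appear in an arc $a$ and $v_i$ precedes $v_j$ in $a$, we say $v_i$ dominates $v_j$ in $a$. A path in $T$ is a sequence $v_1a_1v_2a_2\cdots a_{t-1}v_t$ of distinct vertices $v_1,\dots,v_t$ ($t\geq1$) and distinct arcs $a_1,\dots,a_{t-1}$ such that $v_i$ precedes $v_{i+1}$ in $a_i$; its length is the number $t-1$ of arcs, and it is an $(x,y)$-path if $v_1=x$, $v_t=y$. For integers $i,j\geq1$, the $(i,j)$-step competition graph $C_{i,j}(T)$ is the graph on $V(T)$ in which $xy$ is an edge if and only if there exist a vertex $z\neq x,y$, an $(x,z)$-path $P$ and a $(y,z)$-path $Q$ such that: $y\notin V(P)$ and $x\notin V(Q)$; either ($l(P)\leq i$ and $l(Q)\leq j$) or ($l(Q)\leq i$ and $l(P)\leq j$); and $P$, $Q$ have no arc in common. $P_m$ denotes the path on $m$ vertices, so $K_n-E(P_2)$ is $K_n$ with one edge removed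 and $K_n-E(P_3)$ is $K_n$ with two edges sharing a vertex removed; $K_{n-1}\cup K_1$ is the disjoint union of a complete graph on $n-1$ vertices and an isolated vertex. *)

(* Defs.v *)
From mathcomp Require Import all_boot.

Set Implicit Arguments.
Unset Strict Implicit.
Unset Printing Implicit Defensive.

(** * Finite simple graphs *)

(* Adjacency is Prop-valued because the competition relation quantifies over
   sequences. *)
Record sgraph := SGraph {
  vertex :> finType;
  adj : vertex -> vertex -> Prop;
  adj_sym : forall x y, adj x y -> adj y x;
  adj_irrefl : forall x, ~ adj x x }.

Definition isomorphic (G H : sgraph) : Prop :=
  exists2 f : G -> H, bijective f & forall x y, adj x y <-> adj (f x) (f y).

Notation "G ≅ H" := (isomorphic G H) (at level 70).

Section Complete.
Variable n : nat.

Definition complete_adj (i j : 'I_n) : Prop := i <> j.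

Lemma complete_sym i j : complete_adj i j -> complete_adj j i.
Proof. exact: nesym. Qed.

Lemma complete_irrefl i : ~ complete_adj i i.
Proof. by []. Qed.

Definition complete := SGraph complete_sym complete_irrefl.
End Complete.

Notation "''K_' n" := (complete n) (at level 8, n at level 2, format "''K_' n").

(* The path with m vertices is 0 - 1 - ... - (m - 1) inside {0, ..., n - 1};
   this is K_n - E(P_m) provided m <= n. *)
Section CompleteMinusPath.
Variables n m : nat.

Definition path_edge (i j : 'I_n) : Prop :=
  [/\ i < m, j < m & j = i.+1 :> nat \/ i = j.+1 :> nat].

Definition complete_minus_path_adj (i j : 'I_n) : Prop :=
  i <> j /\ ~ path_edge i j.

Lemma complete_minus_path_sym i j :
  complete_minus_path_adj i j -> complete_minus_path_adj j i.
Proof.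
move=> [ij nP]; split; first exact: nesym.
by case=> jm im e; apply: nP; split=> //; case: e; [right | left].
Qed.

Lemma complete_minus_path_irrefl i : ~ complete_minus_path_adj i i.
Proof. by case. Qed.

Definition complete_minus_path :=
  SGraph complete_minus_path_sym complete_minus_path_irrefl.
End CompleteMinusPath.

Section DisjointUnion.
Variables G H : sgraph.

Definition dunion_adj (x y : G + H) : Prop :=
  match x, y with
  | inl u, inl v => adj u v
  | inr u, inr v => adj u v
  | _, _ => False
  end.

Lemma dunion_sym x y : dunion_adj x y -> dunion_adj y x.
Proof. by case: x y => [x|x] [y|y] //=; exact: adj_sym. Qed.

Lemma dunion_irrefl x : ~ dunion_adj x x.
Proof. by case: x => x /=; exact: adj_irrefl. Qed.

Definition dunion := SGraph dunion_sym dunion_irrefl.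
End DisjointUnion.

(** * Hypertournaments *)

Record hypertournament (k : nat) := Hypertournament {
  hvertex :> finType;
  arcs : {set k.-tuple hvertex};
  arcs_uniq : forall a, a \in arcs -> uniq a;
  arcs_orient : forall S : {set hvertex}, #|S| = k ->
    exists! a : k.-tuple hvertex, a \in arcs /\ [set x in a] = S }.

Section Competition.
Variables (k : nat) (T : hypertournament k).

(* Arcs have no repeated entry, so index gives the position of a vertex. *)
Definition dominates (a : k.-tuple T) (u v : T) : Prop :=
  [/\ u \in a, v \in a & index u a < index v a].

(* A sequence v_1 a_1 v_2 ... a_(t-1) v_t is represented by its first vertex
   v_1 and the list [:: (a_1, v_2); ...; (a_(t-1), v_t)]. *)
Definition steps := seq (k.-tuple T * T).

Definition path_vertices (x : T) (p : steps) : seq T := x :: unzip2 p.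
Definition path_arcs (p : steps) : seq (k.-tuple T) := unzip1 p.
Definition path_length (p : steps) : nat := size p.

Fixpoint dominating (x : T) (p : steps) : Prop :=
  if p is (a, y) :: p' then [/\ a \in arcs T, dominates a x y & dominating y p']
  else True.

Definition is_path (x z : T) (p : steps) : Prop :=
  [/\ dominating x p, last x (unzip2 p) = z,
      uniq (path_vertices x p) & uniq (path_arcs p)].

Variables i j : nat.

Definition competition_adj (x y : T) : Prop :=
  exists (z : T) (P Q : steps),
    [/\ z <> x /\ z <> y,
        is_path x z P /\ is_path y z Q,
        y \notin path_vertices x P /\ x \notin path_vertices y Q,
        (path_length P <= i /\ path_length Q <= j) \/
        (path_length Q <= i /\ path_length P <= j)
      & forall a, ~ (a \in path_arcs P /\ a \in path_arcs Q)].

Lemma competition_sym x y : competition_adj x y -> competition_adj y x.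
Proof.
move=> [z [P [Q [[zx zy] [pP pQ] [yP xQ] len dis]]]].
exists z, Q, P; split=> //; first by case: len; [right | left].
by move=> a [aQ aP]; apply: (dis a).
Qed.

Lemma competition_irrefl x : ~ competition_adj x x.
Proof. by move=> [z [P [Q [_ _ [+ _] _ _]]]]; rewrite mem_head. Qed.

Definition competition_graph := SGraph competition_sym competition_irrefl.
End Competition.

(* Main.v *)
(** Suppose that x and y are not adjacent.  If p has x before some z <> y and q
    has y before some w <> x, with p <> q, then every arc through z and w is p
    or q, since any other arc completes a path of length two; this is possible
    only for n = 4 and k = 3.  Otherwise one of x, y precedes nothing but the
    other, or there is a single arc outside of which both precede at most each
    other.  In each case most vertices lie before x (or y) in all but one arc,
    so that nearly all pairs compete for x or y, and what remains is at most one
    more non-edge, or an isolated vertex.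

    Conversely, each of the four graphs is realized by ordering every k-set
    by a fixed linear order, except for at most four vertices, which come last in an
    order that may depend on which of them belong to the set. *)

Require Import Defs.
From mathcomp Require Import all_boot zify.
From Stdlib Require Import Classical.

Set Implicit Arguments.
Unset Strict Implicit.
Unset Printing Implicit Defensive.

Ltac distinct :=
  rewrite /= ?inE ?negb_or; repeat (apply/andP; split); try done;
  apply/eqP; congruence.

Lemma isomorphic_sym G H : G ≅ H -> H ≅ G.
Proof.
case=> f [g fK gK] fadj; exists g; first by exists f.
by move=> x y; rewrite fadj !gK.
Qed.

Lemma isomorphic_trans G H K : G ≅ H -> H ≅ K -> G ≅ K.
Proof.
case=> f bij_f fadj [g bij_g gadj]; exists (g \o f); first exact: bij_comp.
by move=> x y; rewrite fadj gadj.
Qed.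

Lemma labelling_prefix (V : finType) (s : seq V) : uniq s ->
  exists2 f : V -> 'I_#|V|, bijective f & {in s, forall v, f v = index v s :> nat}.
Proof.
move=> us; pose t := s ++ filter [predC s] (enum V).
have ut : uniq t.
  rewrite cat_uniq us filter_uniq ?enum_uniq // andbT.
  by apply/hasPn=> v; rewrite mem_filter => /andP[].
have mt v : v \in t by rewrite mem_cat mem_filter mem_enum /= andbT orbN.
have st : size t = #|V|.
  by rewrite cardT; apply: perm_size; apply: uniq_perm; rewrite ?enum_uniq // => v;
    rewrite mt mem_enum.
have lt v : index v t < #|V| by rewrite -st index_mem.
exists (fun v => Ordinal (lt v)); last by move=> v vs /=; rewrite index_cat vs.
apply: inj_card_bij; last by rewrite card_ord.
by move=> u v [] /(congr1 (nth u t)); rewrite !nth_index.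
Qed.

Lemma iso_complete (G : sgraph) :
  (forall u v : G, u <> v -> adj u v) -> G ≅ 'K_#|G|.
Proof.
move=> adjG; have [f bij_f _] := @labelling_prefix G [::] isT.
exists f => // x y; split=> [xy /(bij_inj bij_f) e|nf].
  by apply: (@adj_irrefl G x); rewrite {2}e.
by apply: adjG => e; apply: nf; rewrite e.
Qed.

Lemma iso_minus_edge (G : sgraph) (x y : G) : x <> y -> ~ adj x y ->
  (forall u v : G, u <> v -> ~ adj u v -> (u = x /\ v = y) \/ (u = y /\ v = x)) ->
  G ≅ complete_minus_path #|G| 2.
Proof.
move=> xy nxy nadj.
have [|f bij_f fE] := @labelling_prefix G [:: x; y]; first by distinct.
have fx : f x = 0 :> nat by rewrite fE ?inE /= ?eqxx.
have fy : f y = 1 :> nat.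
  by rewrite fE ?inE ?eqxx ?orbT //= eqxx; case: eqP.
exists f => // u v; split=> [uv|[nf nP]].
  split=> [/(bij_inj bij_f) e|[fu fv fuv]].
    by apply: (@adj_irrefl G u); rewrite {2}e.
  have {fu fv fuv} : (f u = f x /\ f v = f y) \/ (f u = f y /\ f v = f x).
    have n2 (i j : nat) : i < 2 -> j < 2 -> j = i.+1 \/ i = j.+1 ->
      (i = 0 /\ j = 1) \/ (i = 1 /\ j = 0) by lia.
    by case: (n2 _ _ fu fv fuv) => -[eu ev]; [left|right]; split; apply: val_inj;
      rewrite /= ?fx ?fy.
  have inj_f := bij_inj bij_f.
  case=> -[/inj_f eu /inj_f ev]; subst; first by [].
  by apply: nxy; apply: adj_sym.
apply: NNPP => nuv; apply: nP.
case: (nadj _ _ _ nuv) => [e|[-> ->]|[-> ->]]; first by apply: nf; rewrite e.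
  by split; rewrite ?fx ?fy //; left.
by split; rewrite ?fx ?fy //; right.
Qed.

Definition nonedges_in_cherry (G : sgraph) (x y z : G) :=
  forall u v : G, u <> v -> ~ adj u v ->
    (u = x /\ (v = y \/ v = z)) \/ (v = x /\ (u = y \/ u = z)).

Lemma iso_minus_cherry (G : sgraph) (x y z : G) :
  x <> y -> x <> z -> y <> z -> ~ adj x y -> ~ adj x z ->
  nonedges_in_cherry x y z -> G ≅ complete_minus_path #|G| 3.
Proof.
move=> xy xz yz nxy nxz nadj.
have [|f bij_f fE] := @labelling_prefix G [:: y; x; z]; first by distinct.
have fy : f y = 0 :> nat by rewrite fE ?inE /= ?eqxx.
have fx : f x = 1 :> nat.
  by rewrite fE ?inE ?eqxx ?orbT //= eqxx; case: eqP => // e; case: xy.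
have fz : f z = 2 :> nat.
  rewrite fE ?inE ?eqxx ?orbT //= eqxx; case: eqP => // _.
  by case: eqP => // e; case: xz.
have inj_f := bij_inj bij_f.
exists f => // u v; split=> [uv|[nf nP]].
  split=> [/inj_f e|[fu fv fuv]].
    by apply: (@adj_irrefl G u); rewrite {2}e.
  have {fu fv fuv} : [\/ f u = f x /\ f v = f y, f u = f y /\ f v = f x,
                       f u = f x /\ f v = f z | f u = f z /\ f v = f x].
    have n3 (i j : nat) : i < 3 -> j < 3 -> j = i.+1 \/ i = j.+1 ->
      [\/ i = 1 /\ j = 0, i = 0 /\ j = 1, i = 1 /\ j = 2 | i = 2 /\ j = 1].
      by case: i j => [|[|[|i]]] [|[|[|j]]] //=; lia || by constructor.
    by case: (n3 _ _ fu fv fuv) => -[eu ev];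
      [constructor 1|constructor 2|constructor 3|constructor 4]; split;
      apply: val_inj; rewrite /= ?fx ?fy ?fz.
  by case=> -[/inj_f eu /inj_f ev]; subst; [apply: nxy | apply: nxy; apply: adj_sym
    | apply: nxz | apply: nxz; apply: adj_sym].
apply: NNPP => nuv; apply: nP.
case: (nadj _ _ _ nuv) => [e|[->]|[->]]; first by apply: nf; rewrite e.
  by case=> ->; split; rewrite ?fx ?fy ?fz //; [right|left].
by case=> ->; split; rewrite ?fx ?fy ?fz //; [left|right].
Qed.

Lemma iso_isolated (G : sgraph) (x : G) : (forall u, ~ adj x u) ->
  (forall u v : G, u <> v -> u <> x -> v <> x -> adj u v) ->
  G ≅ dunion 'K_(#|G| - 1) 'K_1.
Proof.
move=> iso_x adjG.
have [f bij_f fE] := @labelling_prefix G [:: x] isT.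
have {fE} fx : f x = 0 :> nat by rewrite fE ?inE /= ?eqxx.
move: f bij_f fx; have : 0 < #|G| by apply/card_gt0P; exists x.
case: #|G| => // m _ f [g fK gK] /= fx; rewrite subn1 /=.
have {}fx : f x = ord0 by apply: val_inj.
pose h (o : option 'I_m) : dunion 'K_m 'K_1 :=
  if o is Some j then inl j else inr ord0.
exists (fun v => h (unlift ord0 (f v))).
  exists (fun w => g (match w with inl j => lift ord0 j | inr _ => ord0 end)).
    by move=> v; case: unliftP => [j|] /= <-; rewrite fK.
  by case=> [j|j] /=; rewrite gK ?liftK // unlift_none /= (ord1 j).
move=> u v; split=> [uv|].
  case: unliftP => [i|] fu; case: unliftP => [j|] fv //=.
  - move=> e; apply: (@adj_irrefl G u).
    by rewrite -{2}[u]fK fu e -fv fK.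
  - case: (iso_x u); apply: adj_sym; suff <- : v = x by [].
    by rewrite -[v]fK fv -fx fK.
  - by case: (iso_x v); suff <- : u = x by []; rewrite -[u]fK fu -fx fK.
  case: (iso_x v); suff <- : u = x by []; by rewrite -[u]fK fu -fx fK.
case: unliftP => [i|] fu; case: unliftP => [j|] fv //= ij.
have ne w l : f w = lift ord0 l -> w <> x by move=> fw e; move: fw; rewrite e fx.
apply: adjG; [|exact: ne fu|exact: ne fv].
by move=> e; apply: ij; apply: (@lift_inj _ ord0); rewrite -fu -fv e.
Qed.

Section Arrows.
Variables (k : nat) (T : hypertournament k).
Implicit Types (a b c p q r : k.-tuple T) (u v w x y z : T).

Local Notation adj12 := (@competition_adj k T 1 2).

Definition arrow a u v := a \in arcs T /\ dominates a u v.

Lemma arrow_mem a u v : arrow a u v -> [/\ a \in arcs T, u \in a & v \in a].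
Proof. by case=> ? []. Qed.

Lemma arrow_neq a u v : arrow a u v -> u <> v.
Proof. by case=> _ [_ _ lt] e; rewrite e ltnn in lt. Qed.

Lemma arrow_trans a u v w : arrow a u v -> arrow a v w -> arrow a u w.
Proof. by case=> aT [ua _ uv] [_ [_ wa vw]]; split=> //; split=> //; lia. Qed.

Lemma arrow_total a u v : a \in arcs T -> u \in a -> v \in a -> u <> v ->
  arrow a u v \/ arrow a v u.
Proof.
move=> aT ua va uv; case: (ltngtP (index u a) (index v a)) => e.
- by left.
- by right.
by case: uv; rewrite -(nth_index u ua) e nth_index.
Qed.

Lemma arrow_of_not a u v : a \in arcs T -> u \in a -> v \in a -> u <> v ->
  ~ arrow a v u -> arrow a u v.
Proof. by move=> aT ua va uv nvu; case: (arrow_total aT ua va uv). Qed.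

Lemma arc_neq a b u : u \in a -> u \notin b -> a <> b.
Proof. by move=> ua ub e; rewrite -e ua in ub. Qed.

Lemma arc_exists (I O : seq T) : uniq (I ++ O) -> size I <= k ->
  size O + k <= #|T| ->
  exists2 a, a \in arcs T & all [in a] I && all [predC a] O.
Proof.
rewrite cat_uniq => /and3P[uI /hasPn IO uO] Ik Ok.
pose R := filter [predC I ++ O] (enum T).
have uIR : uniq (I ++ R).
  rewrite cat_uniq uI filter_uniq ?enum_uniq // andbT.
  by apply/hasPn=> v; rewrite mem_filter /= mem_cat negb_or => /andP[/andP[]].
have sz : size (I ++ R) + size O = #|T|.
  rewrite -size_cat cardT; apply: perm_size; apply: uniq_perm; rewrite ?enum_uniq //.
    rewrite cat_uniq uIR uO andbT /=; apply/hasPn=> v vO.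
    rewrite mem_cat negb_or IO // mem_filter /= mem_cat negb_and negbK.
    by rewrite [v \in O]vO orbT.
  move=> v; rewrite !mem_cat mem_filter /= mem_cat mem_enum /= andbT.
  by case: (v \in I); case: (v \in O).
pose s := take k (I ++ R).
have ss : size s = k by rewrite size_takel //; lia.
have cS : #|[set x in s]| = k by rewrite cardsE (card_uniqP _) ?take_uniq.
have [a [[aT /setP aS] _]] := arcs_orient cS.
have {}aS v : (v \in a) = (v \in s) by have := aS v; rewrite !inE.
exists a => //; apply/andP; split; apply/allP=> v vI /=; rewrite aS /s.
  by rewrite take_cat ltnNge Ik /= mem_cat vI.
apply: contraL (vI) => /mem_take; rewrite mem_cat mem_filter /= mem_cat negb_or.
by case/orP=> [vv|/andP[/andP[]]] //; apply: contraL vv => /IO.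
Qed.

Lemma adj_common x y z p q : x <> y -> p <> q -> arrow p x z -> arrow q y z ->
  adj12 x y.
Proof.
move=> xy pq xz yz; have nx := arrow_neq xz; have ny := arrow_neq yz.
case: xz yz => pT xz [qT yz].
exists z, [:: (p, z)], [:: (q, z)]; split=> //=.
- by split; congruence.
- by split; split=> //; distinct.
- by rewrite /path_vertices; split; distinct.
- by left.
by move=> a; rewrite !inE => -[/eqP-> /eqP].
Qed.

Lemma adj_two_step x y z w p q r : x <> y -> x <> w -> y <> z ->
  p <> q -> p <> r -> q <> r ->
  arrow p x z -> arrow q y w -> arrow r w z -> adj12 x y.
Proof.
move=> xy xw yz pq pr qr xz yw wz.
have nx := arrow_neq xz; have ny := arrow_neq yw; have nz := arrow_neq wz.
case: xz yw wz => pT xz [qT yw] [rT wz].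
exists z, [:: (p, z)], [:: (q, w); (r, z)]; split=> //=.
- by split; congruence.
- by split; split=> //; distinct.
- by rewrite /path_vertices; split; distinct.
- by left.
by move=> a; rewrite !inE => -[/eqP-> /orP[]/eqP].
Qed.

Lemma adj_out x y : adj12 x y -> exists p z, arrow p x z /\ z <> y.
Proof.
case=> z [P [Q [[zx zy] [[dP lP _ _] _] [yP _] _ _]]].
case: P dP lP yP => [|[a w] P] /=; first by move=> _ e; case: zx.
case=> aT xw _ _; rewrite /path_vertices /= !inE !negb_or => /and3P[_ /eqP yw _].
by exists a, w; split; [split|congruence].
Qed.

End Arrows.

Section Classification.
Variables (k : nat) (T : hypertournament k).
Hypotheses (k3 : 3 <= k) (kT : k < #|T|).
Implicit Types (a b c p q r : k.-tuple T) (u v w x y z : T).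

Local Notation adj12 := (@competition_adj k T 1 2).
Local Notation cherry := (@nonedges_in_cherry (competition_graph T 1 2)).

Lemma arc_pair x y : x <> y -> exists2 a, a \in arcs T & x \in a /\ y \in a.
Proof.
move=> xy; have [|||a aT] := @arc_exists k T [:: x; y] [::] => //=;
  try (exact: kT || exact: ltnW); try lia.
  by distinct.
by rewrite !andbT => /andP[]; exists a.
Qed.

Lemma arc_pair_avoiding x y z : x <> y -> x <> z -> y <> z ->
  exists2 a, a \in arcs T & [/\ x \in a, y \in a & z \notin a].
Proof.
move=> xy xz yz; have [|||a aT] := @arc_exists k T [:: x; y] [:: z] => //=;
  try (exact: kT || exact: ltnW); try lia.
  by distinct.
by rewrite !andbT -andbA => /and3P[]; exists a.
Qed.

Lemma arc_triple x y z : x <> y -> x <> z -> y <> z ->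
  exists2 a, a \in arcs T & [/\ x \in a, y \in a & z \in a].
Proof.
move=> xy xz yz; have [|||a aT] := @arc_exists k T [:: x; y; z] [::] => //=;
  try (exact: kT || exact: ltnW); try lia.
  by distinct.
by rewrite !andbT => /and3P[]; exists a.
Qed.

Lemma arc_triple_avoiding x y z w : uniq [:: x; y; z; w] ->
  exists2 a, a \in arcs T & [/\ x \in a, y \in a, z \in a & w \notin a].
Proof.
move=> xyzw; have [|||a aT] := @arc_exists k T [:: x; y; z] [:: w] => //=;
  try (exact: kT || exact: ltnW); try lia.
by rewrite !andbT -!andbA => /and4P[]; exists a.
Qed.

Lemma arc_sdr x u v a : x <> u -> x <> v -> u <> v -> exists p q,
  [/\ p \in arcs T, q \in arcs T, x \in p /\ u \in p, x \in q /\ v \in q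
    & [/\ p <> q, p <> a & q <> a]].
Proof.
move=> xu xv uv.
have [p pT [xp up vp]] := arc_pair_avoiding xu xv uv.
have [q qT [xq vq uq]] := arc_pair_avoiding xv xu (nesym uv).
have [r rT [xr ur vr]] := arc_triple xu xv uv.
have pq := arc_neq up uq; have rq := arc_neq ur uq; have rp := arc_neq vr vp.
case: (eqVneq p a) => [<-|/eqP pa].
  by exists r, q; do !split=> //; congruence.
case: (eqVneq q a) => [<-|/eqP qa].
  by exists p, r; do !split=> //; congruence.
by exists p, q.
Qed.

Definition classified :=
  [\/ forall x y, x <> y -> adj12 x y,
      exists2 x, forall u, ~ adj12 x u
        & forall u v, u <> v -> u <> x -> v <> x -> adj12 u v
    | exists x y z, [/\ x <> y, x <> z, y <> z, ~ adj12 x y & cherry x y z]].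

Lemma adj_by_sink x u v a : u <> x -> v <> x -> u <> v ->
  (forall p, p <> a -> ~ arrow p x u) -> (forall p, p <> a -> ~ arrow p x v) ->
  adj12 u v.
Proof.
move=> ux vx uv nu nv.
have [p [q [pT qT [xp up] [xq vq] [pq pa qa]]]] := arc_sdr a (nesym ux) (nesym vx) uv.
apply: (@adj_common _ _ _ _ x p q) => //; apply: arrow_of_not => //; by [apply: nu|apply: nv].
Qed.

Lemma classified_sink x : (forall p z, ~ arrow p x z) -> classified.
Proof.
move=> sink; constructor 2; exists x => [u /adj_out[p [z [/sink]]] //|u v uv ux vx].
have [w xw] : exists w : T, x <> w by exists u; congruence.
have [a _ _] := arc_pair xw.
by apply: (@adj_by_sink x u v a).
Qed.

Lemma nonadj_arcs_through x y p q z w : x <> y -> ~ adj12 x y ->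
  arrow p x z -> z <> y -> arrow q y w -> w <> x -> p <> q ->
  z <> w /\ (forall c, c \in arcs T -> z \in c -> w \in c -> c = p \/ c = q).
Proof.
move=> xy nxy xz zy yw wx pq.
have zw : z <> w by move=> e; apply: nxy; subst w; apply: (adj_common _ _ xz yw).
split=> // c cT zc wc; apply: NNPP => /not_or_and[cp cq].
apply: nxy; case: (arrow_total cT zc wc zw) => cc.
  apply: competition_sym; apply: (@adj_two_step _ _ y x w z q p c) => //; congruence.
by apply: (@adj_two_step _ _ x y z w p q c) => //; congruence.
Qed.

(* Here n = 4 and k = 3, with p = (w, x, z), q = (z, y, w), and the other two arcs
   consist of z, respectively w, followed by x and y in some order. *)
Lemma classified_four x y p q z w : x <> y -> ~ adj12 x y ->
  arrow p x z -> z <> y -> arrow q y w -> w <> x -> p <> q -> classified.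
Proof.
move=> xy nxy xz zy yw wx pq.
have [zw onlypq] := nonadj_arcs_through xy nxy xz zy yw wx pq.
have [pT xp zp] := arrow_mem xz; have [qT yq wq] := arrow_mem yw.
have xNz := arrow_neq xz; have yNw := arrow_neq yw.
have [yp wp] : y \notin p /\ w \in p.
  have [c cT [zc wc yc]] := arc_pair_avoiding zw zy (nesym yNw).
  case: (onlypq c cT zc wc) => e; first by rewrite -e.
  by rewrite -e in yq; rewrite yq in yc.
have [xq zq] : x \notin q /\ z \in q.
  have [c cT [zc wc xc]] := arc_pair_avoiding zw (nesym xNz) wx.
  case: (onlypq c cT zc wc) => e; last by rewrite -e.
  by rewrite -e in xp; rewrite xp in xc.
have V t : [\/ t = x, t = y, t = z | t = w].
  apply: NNPP => nt.
  have [tx ty tz tw] : [/\ t <> x, t <> y, t <> z & t <> w].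
    by split=> e; apply: nt; [constructor 1|constructor 2|constructor 3|constructor 4].
  have tq : t \in q.
    have [|c cT [zc wc tc xc]] := @arc_triple_avoiding z w t x; first by distinct.
    case: (onlypq c cT zc wc) => e; last by rewrite -e.
    by rewrite -e in xp; rewrite xp in xc.
  have k4 : 4 <= k.
    rewrite -(size_tuple q); apply: (@uniq_leq_size _ [:: y; z; w; t]); first by distinct.
    by move=> v; rewrite !inE => /or4P[]/eqP->.
  have [|||c cT] := @arc_exists k T [:: x; y; z; w] [::].
  - by distinct.
  - exact: k4.
  - exact: ltnW.
  rewrite /= !andbT => /and4P[xc yc zc wc].
  case: (onlypq c cT zc wc) => e; first by rewrite -e yc in yp.
  by rewrite -e xc in xq.
have nyz r : ~ arrow r y z.
  move=> yz; apply: nxy; apply: (adj_common _ _ xz yz) => //.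
  by apply: nesym; case: (arrow_mem yz) => _ yr _; apply: arc_neq yr yp.
have nxw r : ~ arrow r x w.
  move=> xw; apply: nxy; apply: (adj_common _ _ xw yw) => //.
  by case: (arrow_mem xw) => _ xr _; apply: arc_neq xr xq.
have onlyp r : arrow r x z -> r = p.
  move=> xz'; have [rT xr zr] := arrow_mem xz'.
  have rq := arc_neq xr xq.
  have [_ only'] := nonadj_arcs_through xy nxy xz' zy yw wx rq.
  by case: (only' p pT zp wp).
have onlyq r : arrow r y w -> r = q.
  move=> yw'; have [rT yr wr] := arrow_mem yw'.
  have pr : p <> r by apply: nesym; apply: arc_neq yr yp.
  have [_ only'] := nonadj_arcs_through xy nxy xz zy yw' wx pr.
  by case: (only' q qT zq wq) => // e; case: pq.
have zyq : arrow q z y by apply: arrow_of_not.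
have wxp : arrow p w x by apply: arrow_of_not.
have [d dT [xd yd wd]] := arc_triple xy (nesym wx) yNw.
have [c cT [xc yc zc]] := arc_triple xy xNz (nesym zy).
have dq := arc_neq xd xq; have dp := arc_neq yd yp.
have cq := arc_neq xc xq; have cp := arc_neq yc yp.
have wyd : arrow d w y by apply: arrow_of_not => //; [congruence|move/onlyq].
have zxc : arrow c z x by apply: arrow_of_not => //; [congruence|move/onlyp].
have adj_zw : adj12 z w by apply: (adj_common _ _ zyq wyd) => //; congruence.
have adj_wx : adj12 w x.
  by apply: (@adj_two_step _ _ w x y z d p q) => //; congruence.
have adj_zy : adj12 z y.
  by apply: (@adj_two_step _ _ z y x w c q p) => //; congruence.
have adj_xz r : arrow r x y -> adj12 x z.
  move=> rxy; apply: (adj_common _ _ rxy zyq) => //.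
  by case: (arrow_mem rxy) => _ xr _; apply: arc_neq xr xq.
have adj_yw r : arrow r y x -> adj12 y w.
  move=> ryx; apply: (adj_common _ _ ryx wxp) => //.
  by case: (arrow_mem ryx) => _ yr _; apply: arc_neq yr yp.
have symm u v : adj12 u v -> adj12 v u by apply: competition_sym.
constructor 3; case: (arrow_total cT xc yc xy) => [/adj_xz xz'|/adj_yw yw'].
  exists y, x, w; split=> //; try congruence; first by move/symm.
  by move=> u v /= uv nuv; case: (V u) => e; case: (V v) => e'; subst => //;
    try (by case: nuv; auto); auto.
exists x, y, z; split=> //; try congruence.
by move=> u v /= uv nuv; case: (V u) => e; case: (V v) => e'; subst => //;
    try (by case: nuv; auto); auto.
Qed.

(* Outside the arc [a], both vertices precede at most each other. *)
Definition single_exit x y a := [/\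
  exists2 z, arrow a x z & z <> y,
  exists2 z, arrow a y z & z <> x,
  forall p z, p <> a -> arrow p x z -> z = y
  & forall p z, p <> a -> arrow p y z -> z = x].

Lemma nonadj_cases x y : x <> y -> ~ adj12 x y -> ~ classified ->
  [\/ forall p z, arrow p x z -> z = y,
      forall p z, arrow p y z -> z = x
    | exists a, single_exit x y a].
Proof.
move=> xy nxy ncl.
case: (classic (forall p z, arrow p x z -> z = y)) => [|outx]; first by constructor 1.
case: (classic (forall p z, arrow p y z -> z = x)) => [|outy]; first by constructor 2.
constructor 3.
have [p [z [xz zy]]] : exists p z, arrow p x z /\ z <> y.
  apply: NNPP => n; apply: outx => p z xz; apply: NNPP => zy.
  by apply: n; exists p, z.
have [q [w [yw wx]]] : exists p z, arrow p y z /\ z <> x.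
  apply: NNPP => n; apply: outy => q w yw; apply: NNPP => wx.
  by apply: n; exists q, w.
have four p' q' z' w' : arrow p' x z' -> z' <> y -> arrow q' y w' -> w' <> x -> p' = q'.
  move=> xz' zy' yw' wx'; apply: NNPP => pq; apply: ncl.
  exact: classified_four xy nxy xz' zy' yw' wx' pq.
have e := four _ _ _ _ xz zy yw wx; subst q.
exists p; split; [by exists z|by exists w| |].
  by move=> r t rp xt; apply: NNPP => ty; apply: rp; apply: four xt ty yw wx.
by move=> r t rp yt; apply: NNPP => tx; apply: rp; apply: esym; apply: four xz zy yt tx.
Qed.

Lemma single_exit_sym x y a : single_exit x y a -> single_exit y x a.
Proof. by case. Qed.

Lemma single_exit_adj x y a b u : x <> y -> single_exit x y a ->
  arrow b x y -> u <> x -> u <> y -> adj12 u x.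
Proof.
move=> xy [[z xz zy] [w yw wx] _ outy] bxy ux uy.
have [_ xa _] := arrow_mem xz; have [_ xb _] := arrow_mem bxy.
have [p pT [up yp xp]] := arc_pair_avoiding uy ux (nesym xy).
apply: (@adj_common _ _ _ _ y p b) => //; first by apply: nesym; apply: arc_neq xb xp.
apply: arrow_of_not => // /outy ue; case: ux; apply: ue.
by apply: nesym; apply: arc_neq xa xp.
Qed.

Lemma single_exit_inner x y a u v : x <> y -> single_exit x y a ->
  u <> x -> u <> y -> v <> x -> v <> y -> u <> v -> adj12 u v.
Proof.
move=> xy [_ _ outx _] ux uy vx vy uv.
by apply: (@adj_by_sink x u v a) => // p pa /outx e; [apply: uy|apply: vy]; apply: e.
Qed.

Lemma classified_single_exit x y a : x <> y -> ~ adj12 x y -> single_exit x y a ->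
  (exists b, arrow b y x) -> classified.
Proof.
move=> xy nxy ex [b byx].
have [[z xz zy] [w yw wx] outx outy] := ex.
have xNz := arrow_neq xz.
constructor 3; exists x, y, z; split=> //; first congruence.
have adj_y u : u <> x -> u <> y -> adj12 u y.
  by move=> ux uy; apply: (single_exit_adj (nesym xy) (single_exit_sym ex) byx).
have adj_x u : u <> x -> u <> y -> u <> z -> adj12 u x.
  move=> ux uy uz.
  case: (classic (exists c, arrow c x y)) => [[c cxy]|ncxy].
    exact: single_exit_adj xy ex cxy ux uy.
  have [p [q [pT qT [yp up] [yq zq] [pq pa qa]]]] :=
    arc_sdr a (nesym uy) (nesym zy) uz.
  apply: (@adj_two_step _ _ u x y z p a q) => //; try congruence.
    by apply: arrow_of_not => // /outy; auto.
  by apply: arrow_of_not => // /outy e; apply: xNz; rewrite e.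
have symm u v : adj12 u v -> adj12 v u by apply: competition_sym.
move=> u v /= uv nuv.
case: (classic (u = x)) => ux.
  subst u; left; split=> //; case: (classic (v = y)); first by left.
  move=> vy; right; apply: NNPP => vz; apply: nuv; apply: symm.
  by apply: adj_x => //; congruence.
case: (classic (v = x)) => vx.
  subst v; right; split=> //; case: (classic (u = y)); first by left.
  by move=> uy; right; apply: NNPP => uz; apply: nuv; apply: adj_x.
case: (classic (u = y)) => uy.
  by subst u; case: nuv; apply: symm; apply: adj_y => //; congruence.
case: (classic (v = y)) => vy; first by subst v; case: nuv; apply: adj_y.
by case: nuv; apply: single_exit_inner ex _ _ _ _ _.
Qed.

Lemma classified_one_target x y : x <> y -> ~ adj12 x y ->
  (forall p z, arrow p x z -> z = y) -> classified.
Proof.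
move=> xy nxy outx; apply: NNPP => ncl.
have symm u v : adj12 u v -> adj12 v u by apply: competition_sym.
have [a axy] : exists a, arrow a x y.
  apply: NNPP => n; apply: ncl; apply: (@classified_sink x) => p z xz.
  by apply: n; exists p; rewrite -(outx _ _ xz).
have adj_in u v : u <> x -> v <> x -> u <> y -> v <> y -> u <> v -> adj12 u v.
  move=> ux vx uy vy uv.
  by apply: (@adj_by_sink x u v a) => // p _ /outx; auto.
apply: (ncl); case: (classic (exists b, arrow b y x)) => [[b byx]|nyx].
  have adj_y u : u <> x -> u <> y -> adj12 u y.
    move=> ux uy; have [p pT [up xp yp]] := arc_pair_avoiding ux uy xy.
    apply: (@adj_common _ _ _ _ x p b) => //.
      by case: (arrow_mem byx) => _ yb _; apply: nesym; apply: arc_neq yb yp.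
    by apply: arrow_of_not => // /outx; auto.
  have lone v : v <> x -> v <> y -> ~ adj12 x v ->
      forall p w, x \notin p -> ~ arrow p v w.
    move=> vx vy nxv p w xp vw.
    case: (nonadj_cases (nesym vx) nxv ncl).
    - by move/(_ _ _ axy); auto.
    - by move/(_ _ _ vw)=> e; case: (arrow_mem vw) => _ _; rewrite e (negbTE xp).
    case=> c [[z xz _] _ _ outv]; case: (arrow_mem xz) => _ xc _.
    have /outv/(_ vw) e : p <> c by apply: nesym; apply: arc_neq xc xp.
    by case: (arrow_mem vw) => _ _; rewrite e (negbTE xp).
  have [z [zx zy nz]] : exists z, [/\ z <> x, z <> y
      & forall v, v <> x -> v <> y -> ~ adj12 x v -> v = z].
    case: (classic (exists z, [/\ z <> x, z <> y & ~ adj12 x z])).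
      case=> z [zx zy nxz]; exists z; split=> // v vx vy nxv.
      apply: NNPP => vz.
      have [p pT [vp zp xp]] := arc_pair_avoiding vz vx zx.
      by case: (arrow_total pT vp zp vz); [apply: (lone v)|apply: (lone z)].
    move=> none.
    have [z /norP[/eqP zx /eqP zy]] : exists z, ~~ ((z == x) || (z == y)).
      apply: NNPP => n; have : #|T| <= 2.
        rewrite cardT -[2]/(size [:: x; y]); apply: uniq_leq_size (enum_uniq _) _.
        move=> v _; rewrite !inE; apply: contraT => nv; case: n; by exists v.
      by lia.
    by exists z; split=> // v vx vy nxv; case: none; exists v.
  constructor 3; exists x, y, z; split=> //; try congruence.
  move=> u v /= uv nuv.
  case: (classic (u = x)) => ux.
    subst u; left; split=> //; case: (classic (v = y)); first by left.
    by move=> vy; right; apply: nz => //; congruence.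
  case: (classic (v = x)) => vx.
    subst v; right; split=> //; case: (classic (u = y)); first by left.
    by move=> uy; right; apply: nz => // /symm.
  case: (classic (u = y)) => uy.
    by subst u; case: nuv; apply: symm; apply: adj_y => //; congruence.
  by case: (classic (v = y)) => vy; case: nuv; [subst v; apply: adj_y|apply: adj_in].
have [b [z yz]] : exists b z, arrow b y z.
  apply: NNPP => n; apply: ncl; apply: (@classified_sink y) => p z yz.
  by apply: n; exists p, z.
have xz : x <> z by move=> e; subst z; apply: nyx; exists b.
have yNz := arrow_neq yz; have [bT yb zb] := arrow_mem yz.
have xb : x \notin b.
  apply/negP=> xb; case: (arrow_total bT xb zb xz) => [/outx|zx]; first by auto.
  by apply: nyx; exists b; apply: arrow_trans yz zx.
have adj_x u : u <> x -> u <> y -> adj12 u x.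
  move=> ux uy.
  have [p pT [up xp yp]] := arc_triple ux uy xy.
  have [q qT [xq yq uq]] := arc_pair_avoiding xy (nesym ux) (nesym uy).
  have pxy : arrow p x y by apply: arrow_of_not => // yx; apply: nyx; exists p.
  apply: (@adj_common _ _ _ _ y p q) => //; first exact: arc_neq up uq.
    by apply: arrow_trans pxy; apply: arrow_of_not => // /outx; auto.
  by apply: arrow_of_not => // yx; apply: nyx; exists q.
have adj_y u : u <> x -> u <> y -> u <> z -> adj12 u y.
  move=> ux uy uz.
  have [p [q [pT qT [xp up] [xq zq] [pq _ _]]]] := arc_sdr a (nesym ux) xz uz.
  apply: (@adj_two_step _ _ u y x z p b q) => //; try congruence.
  - exact: arc_neq xp xb.
  - by apply: nesym; apply: arc_neq xq xb.
  - by apply: arrow_of_not => // /outx; auto.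
  by apply: arrow_of_not => //; [congruence|move/outx; auto].
constructor 3; exists y, x, z; split=> //; try congruence; first by move/symm.
move=> u v /= uv nuv.
case: (classic (u = y)) => uy.
  subst u; left; split=> //; case: (classic (v = x)); first by left.
  by move=> vx; right; apply: NNPP => vz; apply: nuv; apply: symm; apply: adj_y => //; congruence.
case: (classic (v = y)) => vy.
  subst v; right; split=> //; case: (classic (u = x)); first by left.
  by move=> ux; right; apply: NNPP => uz; apply: nuv; apply: adj_y.
case: (classic (u = x)) => ux.
  by subst u; case: nuv; apply: symm; apply: adj_x => //; congruence.
by case: (classic (v = x)) => vx; case: nuv; [subst v; apply: adj_x|apply: adj_in].
Qed.

Theorem competition_classified : classified.
Proof.
apply: NNPP => ncl; apply: (ncl); constructor 1 => x y xy.
apply: NNPP => nxy; apply: (ncl).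
have nyx : ~ adj12 y x by move/competition_sym.
case: (nonadj_cases xy nxy ncl) => [|outy|[a ex]].
- exact: classified_one_target.
- exact: classified_one_target (nesym xy) nyx outy.
have [[z xz _] [w yw _] _ _] := ex.
have [aT xa _] := arrow_mem xz; have [_ ya _] := arrow_mem yw.
case: (arrow_total aT xa ya xy) => e.
  by apply: classified_single_exit (nesym xy) nyx (single_exit_sym ex) _; exists a.
by apply: classified_single_exit xy nxy ex _; exists a.
Qed.

End Classification.

Section RankTournament.
Variables (V : finType) (k : nat) (rank : {set V} -> V -> nat).
Implicit Type S : {set V}.

Definition rank_seq S : seq V := sort (relpre (rank S) leq) (enum S).

Lemma mem_rank_seq S : rank_seq S =i S.
Proof. by move=> v; rewrite mem_sort mem_enum. Qed.

Definition rank_arcs : {set k.-tuple V} :=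
  [set a : k.-tuple V | rank_seq [set x in a] == a].

Lemma rank_arcs_uniq a : a \in rank_arcs -> uniq a.
Proof. by rewrite inE => /eqP <-; rewrite sort_uniq enum_uniq. Qed.

Lemma rank_arcs_orient S : #|S| = k ->
  exists! a : k.-tuple V, a \in rank_arcs /\ [set x in a] = S.
Proof.
move=> cS; have sz : size (rank_seq S) == k by rewrite size_sort -cardE cS.
have aS : [set x in Tuple sz] = S by apply/setP=> v; rewrite inE mem_rank_seq.
exists (Tuple sz); split; first by rewrite inE aS.
by move=> b []; rewrite inE => /eqP bE bS; apply: val_inj; rewrite /= -bE bS.
Qed.

Definition rank_tournament := Hypertournament rank_arcs_uniq rank_arcs_orient.

Lemma arrow_rank_le (a : k.-tuple V) (u v : V) :
  arrow (T := rank_tournament) a u v ->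
  [/\ u \in a, v \in a & rank [set x in a] u <= rank [set x in a] v].
Proof.
case; rewrite inE => /eqP aE [ua va uv]; split=> //.
have sorted_a : sorted (relpre (rank [set x in a]) leq) a.
  by rewrite -[X in sorted _ X]aE; apply: sort_sorted => x y /=; apply: leq_total.
apply: (sorted_ltn_index _ sorted_a) uv => //.
by move=> y x z /=; apply: leq_trans.
Qed.

Lemma rank_arrow (a : k.-tuple V) (u v : V) : a \in rank_arcs ->
  u \in a -> v \in a -> rank [set x in a] u < rank [set x in a] v ->
  arrow (T := rank_tournament) a u v.
Proof.
move=> aT ua va uv.
have uNv : u <> v by move=> e; rewrite e ltnn in uv.
apply: arrow_of_not => //.
by move=> /arrow_rank_le[_ _]; rewrite leqNgt uv.
Qed.

End RankTournament.

Section Constructions.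
Variables (V : finType) (k : nat).
Hypotheses (k3 : 3 <= k) (kV : k < #|V|).
Implicit Types (S : {set V}) (u v w : V).

Local Notation N := #|V|.

Lemma enum_rank_lt v : enum_rank v < N. Proof. exact: ltn_ord. Qed.

Section Isolated.
Variable x : V.

Definition sink_rank (S : {set V}) v := if v == x then N else enum_rank v : nat.

Lemma realize_isolated :
  competition_graph (rank_tournament k sink_rank) 1 2 ≅ dunion 'K_(N - 1) 'K_1.
Proof.
set T := rank_tournament k sink_rank.
have sink p z : ~ @arrow k T p x z.
  move=> xz; have [_ _] := arrow_rank_le xz; have xNz := arrow_neq xz.
  rewrite /sink_rank eqxx; case: eqP => [e|_]; first by case: xNz.
  by rewrite leqNgt enum_rank_lt.
apply: (@iso_isolated (competition_graph T 1 2) x) => [u|u v uv ux vx].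
  by move=> /adj_out[p [z [/sink]]].
have [a _ _] := @arc_pair k T k3 kV u v uv.
exact: (@adj_by_sink k T k3 kV x u v a).
Qed.
End Isolated.

Section MinusPath.
Variables (b : bool) (x y t : V).
Hypotheses (xy : x <> y) (xt : x <> t) (yt : y <> t).

(* The sets containing t end with y, x (with t in between if b holds), the others
   with x, y. *)
Definition flip_rank S v :=
  if v == x then (if t \in S then N + 3 else N)
  else if v == y then N + 1
  else if b && (v == t) then N + 2
  else enum_rank v.

Let T := rank_tournament k flip_rank.
Let adj12 := @competition_adj k T 1 2.

Let rank_x S : flip_rank S x = if t \in S then N + 3 else N.
Proof. by rewrite /flip_rank eqxx. Qed.

Let rank_y S : flip_rank S y = N + 1.
Proof. by rewrite /flip_rank eqxx; case: eqP => // e; case: xy. Qed.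

Let rank_t S : b -> flip_rank S t = N + 2.
Proof.
rewrite /flip_rank eqxx => ->; case: eqP => [e|_]; first by case: xt.
by case: eqP => // e; case: yt.
Qed.

Let rank_other S v : v <> x -> v <> y -> ~ (b /\ v = t) -> flip_rank S v < N.
Proof.
rewrite /flip_rank => /eqP/negbTE-> /eqP/negbTE-> nt.
by case: ifP => [/andP[bT /eqP vt]|_]; [case: nt | exact: enum_rank_lt].
Qed.

Let out_x p z : @arrow k T p x z -> z = y.
Proof.
move=> xz; have [_ zp] := arrow_rank_le xz; have xNz := arrow_neq xz.
rewrite rank_x inE => le; apply: NNPP => zy.
case: (classic (b /\ z = t)) => [[bT zt]|nt].
  by move: le zp; rewrite zt rank_t //; case: (t \in p) => //; lia.
have := leq_ltn_trans le (rank_other _ (nesym xNz) zy nt).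
by case: (t \in p); lia.
Qed.

Let out_t p z : b -> @arrow k T p t z -> z = x.
Proof.
move=> bT tz; have [tp zp] := arrow_rank_le tz; have tNz := arrow_neq tz.
rewrite rank_t // => le; apply: NNPP => zx.
have [zy|zy] := classic (z = y); first by move: le; rewrite zy rank_y; lia.
have := leq_ltn_trans le (rank_other _ zx zy (fun h => tNz (esym (proj2 h)))).
by lia.
Qed.

Let arrow_x v p : p \in arcs T -> v \in p -> x \in p -> v <> x -> v <> y ->
  @arrow k T p v x.
Proof.
move=> pT vp xp vx vy; apply: arrow_of_not => // /out_x; exact: vy.
Qed.

Let arrow_y v p : p \in arcs T -> v \in p -> y \in p -> v <> x -> v <> y ->
  ~ (b /\ v = t) -> @arrow k T p v y.
Proof.
move=> pT vp yp vx vy nt; apply: rank_arrow => //.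
by rewrite rank_y; apply: ltn_addr; apply: rank_other.
Qed.

Let nadj_xy : ~ adj12 x y.
Proof. by move=> /adj_out[p [z [/out_x]]]. Qed.

Let nadj_xt : b -> ~ adj12 x t.
Proof. by move=> bT /competition_sym/adj_out[p [z [/(out_t bT)]]]. Qed.

Let adj_inner u v : u <> v -> u <> x -> v <> x -> u <> y -> v <> y -> adj12 u v.
Proof.
move=> uv ux vx uy vy; have [a _ _] := @arc_pair k T k3 kV u v uv.
by apply: (@adj_by_sink k T k3 kV x u v a) => // p _ /out_x.
Qed.

Let adj_x v : v <> x -> v <> y -> ~ (b /\ v = t) -> adj12 v x.
Proof.
move=> vx vy nt.
have [p pT [xp yp tp]] := @arc_pair_avoiding k T k3 kV x y t xy xt yt.
have [q qT [vq yq xq]] := @arc_pair_avoiding k T k3 kV v y x vy vx (nesym xy).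
apply: (@adj_common k T v x y q p) => //.
- by apply: nesym; apply: arc_neq xp xq.
- exact: arrow_y.
by apply: rank_arrow => //; rewrite rank_x rank_y inE (negbTE tp); lia.
Qed.

Let adj_y v : v <> x -> v <> y -> adj12 v y.
Proof.
move=> vx vy.
have [p pT [yp tp xp]] := @arc_triple k T k3 kV y t x yt (nesym xy) (nesym xt).
have [q qT [vq xq yq]] := @arc_pair_avoiding k T k3 kV v x y vx vy xy.
apply: (@adj_common k T v y x q p) => //.
- by apply: nesym; apply: arc_neq yp yq.
- exact: arrow_x.
by apply: rank_arrow => //; rewrite rank_x rank_y inE tp; lia.
Qed.

Let symm u v : adj12 u v -> adj12 v u.
Proof. exact: competition_sym. Qed.

Lemma realize_minus_path :
  competition_graph T 1 2 ≅ complete_minus_path N (if b then 3 else 2).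
Proof.
have nonadj u v : u <> v -> ~ adj12 u v ->
    (u = x /\ (v = y \/ (b /\ v = t))) \/ (v = x /\ (u = y \/ (b /\ u = t))).
  move=> uv nuv.
  have [ux|ux] := classic (u = x).
    subst u; left; split=> //; have [vy|vy] := classic (v = y); first by left.
    by right; apply: NNPP => nt; apply/nuv/symm/adj_x => //; apply: nesym.
  have [vx|vx] := classic (v = x).
    subst v; right; split=> //; have [uy|uy] := classic (u = y); first by left.
    by right; apply: NNPP => nt; apply/nuv/adj_x.
  have [uy|uy] := classic (u = y).
    by subst u; case: nuv; apply/symm/adj_y => //; apply: nesym.
  by have [vy|vy] := classic (v = y); case: nuv; [subst v; apply: adj_y|apply: adj_inner].
case: ifP => bE.
  apply: (@iso_minus_cherry (competition_graph T 1 2) x y t) => //.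
    exact: nadj_xt.
  by move=> u v uv nuv; case: (nonadj u v uv nuv) => -[-> [->|[_ ->]]]; auto.
apply: (@iso_minus_edge (competition_graph T 1 2) x y) => //.
by move=> u v uv nuv; case: (nonadj u v uv nuv) => -[-> [->|[bT _]]]; auto;
  rewrite bT in bE.
Qed.
End MinusPath.

Section Complete4.
Variables (e0 e1 e2 e3 : V).
Hypothesis e_uniq : uniq [:: e0; e1; e2; e3].

(* A set meeting {e0, e1, e2, e3} in three elements lists them in cyclic order,
   starting after the missing one. *)
Definition cyclic_tail S : seq V :=
  if e3 \notin S then [:: e0; e1; e2; e3]
  else if e0 \notin S then [:: e1; e2; e3; e0]
  else if e1 \notin S then [:: e2; e3; e0; e1]
  else [:: e3; e0; e1; e2].

Definition cyclic_rank S v :=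
  if v \in cyclic_tail S then N + index v (cyclic_tail S) else enum_rank v.

Let T := rank_tournament k cyclic_rank.
Let adj12 := @competition_adj k T 1 2.

Let cyclic_triple a b c d := forall p, p \in arcs T ->
  a \in p -> b \in p -> c \in p -> d \notin p ->
  @arrow k T p a b /\ @arrow k T p b c.

Let cyclic_tailP S :
  cyclic_tail S =i [:: e0; e1; e2; e3] /\ uniq (cyclic_tail S).
Proof.
have rotP i : rot i [:: e0; e1; e2; e3] =i [:: e0; e1; e2; e3] /\
    uniq (rot i [:: e0; e1; e2; e3]).
  by split=> [v|]; rewrite ?mem_rot ?rot_uniq.
by rewrite /cyclic_tail; case: ifP => _; [exact: (rotP 0)|];
  case: ifP => _; [exact: (rotP 1)|]; case: ifP => _; [exact: (rotP 2)|exact: (rotP 3)].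
Qed.

Let triple_of_tail a b c d : (forall S, a \in S -> b \in S -> c \in S ->
  d \notin S -> cyclic_tail S = [:: a; b; c; d]) -> cyclic_triple a b c d.
Proof.
move=> tailE p pT ap bp cp dp.
have tE : cyclic_tail [set v in p] = [:: a; b; c; d] by apply: tailE; rewrite inE.
have [_] := cyclic_tailP [set v in p]; rewrite tE /= !inE !negb_or.
case/and4P=> /and3P[ab ac _] /andP[bc _] _ _.
by split; apply: rank_arrow => //; rewrite /cyclic_rank tE !inE !eqxx ?orbT /=
  !eqxx ?(negbTE ab) ?(negbTE ac) ?(negbTE bc) /=; lia.
Qed.

Let arrow_tail v w p : p \in arcs T -> v \in p -> w \in p ->
  v \notin [:: e0; e1; e2; e3] -> w \in [:: e0; e1; e2; e3] -> @arrow k T p v w.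
Proof.
move=> pT vp wp ve we; apply: rank_arrow => //; rewrite /cyclic_rank.
have [-> _] := cyclic_tailP [set v in p]; have [-> _] := cyclic_tailP [set v in p].
by rewrite (negbTE ve) we ltn_addr // enum_rank_lt.
Qed.

Let adj_quad a b c d : [:: a; b; c; d] =i [:: e0; e1; e2; e3] ->
  uniq [:: a; b; c; d] ->
  cyclic_triple a b c d -> cyclic_triple b c d a -> cyclic_triple c d a b ->
  cyclic_triple d a b c ->
  [/\ adj12 a b, adj12 a c & forall v, v \notin [:: e0; e1; e2; e3] -> adj12 v a].
Proof.
move=> eE quad tabc tbcd tcda tdab.
have triple u v w s : uniq [:: u; v; w; s] -> cyclic_triple u v w s -> exists p,
    [/\ @arrow k T p u v, @arrow k T p v w, @arrow k T p u w, w \in p & s \notin p].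
  move=> us ts; have [p pT [up vp wp sp]] := @arc_triple_avoiding k T k3 kV u v w s us.
  have [uv vw] := ts p pT up vp wp sp.
  by exists p; split=> //; apply: arrow_trans uv vw.
have [p [pab pbc pac cp dp]] := triple _ _ _ _ quad tabc.
have [|q [qbc qcd qbd dq aq]] := triple b c d a _ tbcd.
  by rewrite -(rot_uniq 3).
have [|r [rcd rda rca ar br]] := triple c d a b _ tcda.
  by rewrite -(rot_uniq 2).
have [|s [sda sab sdb bs cs]] := triple d a b c _ tdab.
  by rewrite -(rot_uniq 1).
have [_ ap bp] := arrow_mem pab.
have [_ cr _] := arrow_mem rcd.
move: quad; rewrite /= !inE !negb_or.
case/and4P=> /and3P[/eqP ab /eqP ac /eqP ad] /andP[/eqP bc /eqP bd] /eqP cd _.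
split.
- by apply: (@adj_common k T a b c p q) => //; apply: arc_neq ap aq.
- apply: (@adj_two_step k T a c b d p r s) => //; try congruence.
  + exact: arc_neq bp br.
  + exact: arc_neq cp cs.
  exact: arc_neq cr cs.
move=> v ve.
have [va vb] : v <> a /\ v <> b.
  by split=> e; move: ve; rewrite -eE e !inE eqxx ?orbT.
have [q' q'T [vq' bq' aq']] := @arc_pair_avoiding k T k3 kV v b a vb va (nesym ab).
apply: (@adj_common k T v a b q' p) => //.
  by apply: nesym; apply: arc_neq ap aq'.
by apply: arrow_tail => //; rewrite -eE !inE eqxx orbT.
Qed.

Lemma realize_complete : competition_graph T 1 2 ≅ 'K_N.
Proof.
have t0 : cyclic_triple e0 e1 e2 e3.
  by apply: triple_of_tail => S h0 h1 h2 h3; rewrite /cyclic_tail h3.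
have t1 : cyclic_triple e1 e2 e3 e0.
  by apply: triple_of_tail => S h1 h2 h3 h0; rewrite /cyclic_tail h3 h0.
have t2 : cyclic_triple e2 e3 e0 e1.
  by apply: triple_of_tail => S h2 h3 h0 h1; rewrite /cyclic_tail h3 h0 h1.
have t3 : cyclic_triple e3 e0 e1 e2.
  by apply: triple_of_tail => S h3 h0 h1 h2; rewrite /cyclic_tail h3 h0 h1.
have rotE i : rot i [:: e0; e1; e2; e3] =i [:: e0; e1; e2; e3].
  by move=> v; rewrite mem_rot.
have rotU i : uniq (rot i [:: e0; e1; e2; e3]) by rewrite rot_uniq.
have [a01 a02 av0] := @adj_quad e0 e1 e2 e3 (rotE 0) (rotU 0) t0 t1 t2 t3.
have [a12 a13 av1] := @adj_quad e1 e2 e3 e0 (rotE 1) (rotU 1) t1 t2 t3 t0.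
have [a23 a20 av2] := @adj_quad e2 e3 e0 e1 (rotE 2) (rotU 2) t2 t3 t0 t1.
have [a30 a31 av3] := @adj_quad e3 e0 e1 e2 (rotE 3) (rotU 3) t3 t0 t1 t2.
have symm u v : adj12 u v -> adj12 v u by apply: competition_sym.
have av u v : u \notin [:: e0; e1; e2; e3] -> v \in [:: e0; e1; e2; e3] -> adj12 u v.
  by move=> ue; rewrite !inE => /or4P[]/eqP->; auto.
apply: (@iso_complete (competition_graph T 1 2)) => u v uv.
case: (boolP (u \in [:: e0; e1; e2; e3])) => ue;
  case: (boolP (v \in [:: e0; e1; e2; e3])) => ve.
- by move: uv; move: ue ve; rewrite !inE => /or4P[]/eqP-> /or4P[]/eqP-> // _;
    by [|apply: symm].
- by apply/symm/av.
- exact: av.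
have [a _ _] := @arc_pair k T k3 kV u v uv.
have u0 : u <> e0 by move=> e; rewrite e mem_head in ue.
have v0 : v <> e0 by move=> e; rewrite e mem_head in ve.
have [p [q [pT qT [xp up] [xq vq] [pq _ _]]]] :=
  @arc_sdr k T k3 kV e0 u v a (nesym u0) (nesym v0) uv.
by apply: (@adj_common k T u v e0 p q) => //; apply: arrow_tail => //; apply: mem_head.
Qed.
End Complete4.

End Constructions.

Theorem theorem5p1 (n k : nat) (hkn : 3 <= k <= n - 1)
    (G : sgraph) (hG : #|G| = n) :
  (exists T : hypertournament k, #|T| = n /\ G ≅ competition_graph T 1 2) <->
  [\/ G ≅ 'K_n, G ≅ complete_minus_path n 2, G ≅ complete_minus_path n 3
    | G ≅ dunion 'K_(n - 1) 'K_1].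
Proof.
case/andP: hkn => k3 kn; split.
  case=> T [cT GT]; have kT : k < #|T| by rewrite cT; lia.
  rewrite -cT; case: (competition_classified k3 kT) => [all|[x iso_x adjG]|].
  - constructor 1; apply: isomorphic_trans GT _; exact: iso_complete.
  - constructor 4; apply: isomorphic_trans GT _;
    exact: (@iso_isolated (competition_graph T 1 2) x).
  case=> x [y [z [xy xz yz nxy ch]]].
  case: (classic (@competition_adj k T 1 2 x z)) => axz.
    constructor 2; apply: isomorphic_trans GT _.
    apply: (@iso_minus_edge (competition_graph T 1 2) x y) => // u v uv nuv.
    case: (ch u v uv nuv) => -[e [e'|e']]; subst; auto; case: nuv => //.
    exact: competition_sym.
  constructor 3; apply: isomorphic_trans GT _.
  exact: (@iso_minus_cherry (competition_graph T 1 2) x y z).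
case: n kn {hG} => [|[|[|[|m]]]] kn; try lia.
have kV : k < #|'I_m.+4| by rewrite card_ord; lia.
pose e i (h : i < 4) : 'I_m.+4 := Ordinal (leq_trans h (leq_addr m 4)).
have realize (T : hypertournament k) (H : sgraph) : #|T| = m.+4 ->
    G ≅ H -> competition_graph T 1 2 ≅ H ->
    exists T : hypertournament k, #|T| = m.+4 /\ G ≅ competition_graph T 1 2.
  by move=> cT GH TH; exists T; split=> //; apply: isomorphic_trans GH _; apply: isomorphic_sym.
have c4 : #|'I_m.+4| = m.+4 by apply: card_ord.
case=> GH.
- have := realize_complete k3 kV (isT : uniq [:: @e 0 isT; @e 1 isT; @e 2 isT; @e 3 isT]).
  by rewrite c4 => TH; apply: realize GH TH.
- have := @realize_minus_path _ _ k3 kV false (@e 0 isT) (@e 1 isT) (@e 2 isT).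
  by rewrite c4 => TH; apply: realize GH (TH _ _ _).
- have := @realize_minus_path _ _ k3 kV true (@e 0 isT) (@e 1 isT) (@e 2 isT).
  by rewrite c4 => TH; apply: realize GH (TH _ _ _).
have := realize_isolated k3 kV (@e 0 isT).
by rewrite c4 => TH; apply: realize GH TH.
Qed.
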